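(* Let $n\ge 1$ and let $\mathcal{G}\subseteq \mathcal{M}_n(\mathbb{C})$ be a group of unitary matrices. If $\mathcal{G}$ is $\frac{1}{2n^2}$-argument-submultiplicative, then $\mathcal{G}$ is finite modulo its centre, i.e. $\mathcal{G}/Z(\mathcal{G})$ is finite.
   Context: For a complex number $z\neq 0$, $\arg(z)\in(-\pi,\pi]$ denotes its principal argument; $\sigma(M)$ denotes the spectrum of a matrix $M$. A group $\mathcal{G}$ of unitary $n\times n$ matrices is called $\varepsilon'$-argument-submultiplicative ($\varepsilon'$-ASM) if for every $A,B\in\mathcal{G}$ and every $\gamma\in\sigma(AB)$ there exist $\alpha\in\sigma(A)$ and $\beta\in\sigma(B)$ such that $\frac{1}{2\pi}\left|\arg\left(\frac{\alpha\beta}{\gamma}\right)\right|\le \varepsilon'$. $Z(\mathcal{G})$ denotes the centre of $\mathcal{G}$. *)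

(* Defs.v *)
From HB Require Import structures.
From mathcomp Require Import all_boot all_order all_algebra.
From mathcomp Require Import complex.
From mathcomp Require Import all_classical all_reals.
From mathcomp Require Import trigo.
Set Implicit Arguments. Unset Strict Implicit. Unset Printing Implicit Defensive.
Import Order.TTheory GRing.Theory Num.Theory.
Local Open Scope ring_scope.
Local Open Scope classical_set_scope.

Definition is_principal_arg (R : realType) (z : R[i]) (t : R) : Prop :=
  - pi < t <= pi /\ z = `|z| * (cos t +i* sin t)%C.

(* The principal argument (unique for z <> 0). *)
Definition arg (R : realType) (z : R[i]) : R :=
  xget 0 [set t | is_principal_arg z t].

Definition spec (R : realType) (n : nat) (M : 'M[R[i]]_n) (g : R[i]) : Prop :=
  eigenvalue M g.

Definition unitary (R : realType) (n : nat) (M : 'M[R[i]]_n) : Prop :=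
  M *m (map_mx (@conjc R) M)^T = 1%:M.

Definition unitary_group (R : realType) (n : nat) (G : set 'M[R[i]]_n) : Prop :=
  [/\ G 1%:M,
      (forall A B, G A -> G B -> G (A *m B)),
      (forall A, G A -> G (invmx A)) &
      (forall A, G A -> unitary A)].

Definition ASM (R : realType) (n : nat) (eps : R) (G : set 'M[R[i]]_n) : Prop :=
  forall A B, G A -> G B -> forall g, spec (A *m B) g ->
    exists a b, [/\ spec A a, spec B b &
       `|arg (a * b / g)| / (2 * pi) <= eps].

Definition centre (R : realType) (n : nat) (G : set 'M[R[i]]_n) : set 'M[R[i]]_n :=
  [set z | G z /\ forall g, G g -> z *m g = g *m z].

Definition finite_mod_centre (R : realType) (n : nat) (G : set 'M[R[i]]_n) : Prop :=
  finite_set [set [set g *m z | z in centre G] | g in G].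

(* Main.v *)
(* Let [S] in [G] be close to [1], and let [T = g S g^-1] be a conjugate of [S]. For
   the squared Frobenius norm there is an exact formula showing that conjugating [T] by
   the commutator [[S, T]] increases its distance to [S] by at least the square norm of
   [S T - T S]. Hence a conjugate whose distance to [S] is almost maximal almost commutes
   with [S], so that [S^k T^-k] is close to [(S T^-1)^k] for [k] in any prescribed range.
   If [S] is not central, [S T^-1] has an eigenvalue [l <> 1] close to [1], and by
   perturbation every [l^k] is close to an eigenvalue of
   [S^k T^-k = (S^k g S^-k) g^-1]. By argument-submultiplicativity the latter lies within
   angle [pi / N^2] ([N] the dimension) of a ratio of two eigenvalues of [g]. For [N >= 2]
   there are at most [N^2 - 1] such ratios, so these arcs leave a gap on the circle, and
   the powers of [l], which advance by tiny steps, must fall into it. Thus elements near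
   [1] are central, and total boundedness of the unitary group concludes. *)

Require Import Defs.
From HB Require Import structures.
From mathcomp Require Import all_boot all_order all_algebra.
From mathcomp Require Import complex.
From mathcomp Require Import all_classical all_reals.
From mathcomp Require Import trigo.
From mathcomp Require Import sesquilinear spectral ring lra zify.
Import Order.TTheory GRing.Theory Num.Theory.
Set Implicit Arguments. Unset Strict Implicit. Unset Printing Implicit Defensive.
Local Open Scope ring_scope.

(** * The squared Frobenius norm *)

Section Frobenius.
Local Open Scope sesquilinear_scope.
Variable C : numClosedFieldType.
Implicit Types m n p : nat.

Definition frob m n (A : 'M[C]_(m, n)) : C := \tr (A *m A^t*).

Lemma trmxCM m n p (A : 'M[C]_(m, n)) (B : 'M[C]_(n, p)) :
  (A *m B)^t* = B^t* *m A^t*.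
Proof. by rewrite trmx_mul map_mxM. Qed.

Lemma trmxCB m n (A B : 'M[C]_(m, n)) : (A - B)^t* = A^t* - B^t*.
Proof. by rewrite linearB /= map_mxB. Qed.

Lemma trmxC1 n : (1%:M : 'M[C]_n)^t* = 1%:M.
Proof. by rewrite trmx1 map_mx1. Qed.

Lemma mxtrace_trmxC n (A : 'M[C]_n) : \tr (A^t*) = (\tr A)^*.
Proof. by rewrite /mxtrace rmorph_sum; apply: eq_bigr => i _; rewrite !mxE. Qed.

Lemma frobE m n (A : 'M[C]_(m, n)) :
  frob A = \sum_i \sum_j `|A i j| ^+ 2.
Proof.
apply: eq_bigr => i _; rewrite mxE; apply: eq_bigr => j _.
by rewrite !mxE normCK.
Qed.

Lemma frob_ge0 m n (A : 'M[C]_(m, n)) : 0 <= frob A.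
Proof.
by rewrite frobE; apply: sumr_ge0 => i _; apply: sumr_ge0 => j _; rewrite exprn_ge0.
Qed.

Lemma frob_eq0 m n (A : 'M[C]_(m, n)) : frob A = 0 -> A = 0.
Proof.
rewrite frobE => /eqP A0; apply/matrixP => i j; rewrite mxE.
have ge0 k : 0 <= \sum_l `|A k l| ^+ 2 by apply: sumr_ge0 => l _; rewrite exprn_ge0.
move: A0; rewrite psumr_eq0 // => /allP/(_ i (mem_index_enum _))/=.
rewrite psumr_eq0 => [/allP/(_ j (mem_index_enum _))/=|l _]; last exact: exprn_ge0.
by rewrite sqrf_eq0 normr_eq0 => /eqP.
Qed.

Lemma frobN m n (A : 'M[C]_(m, n)) : frob (- A) = frob A.
Proof.
by rewrite !frobE; do 2!apply: eq_bigr => ? _; rewrite mxE normrN.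
Qed.

Lemma frobBC m n (A B : 'M[C]_(m, n)) : frob (A - B) = frob (B - A).
Proof. by rewrite -opprB frobN. Qed.

Lemma frob_trmxC m n (A : 'M[C]_(m, n)) : frob (A^t*) = frob A.
Proof. by rewrite /frob trmxCK mxtrace_mulC. Qed.

Lemma frob_mulUr m n (A : 'M[C]_(m, n)) (U : 'M[C]_n) :
  U \is unitarymx -> frob (A *m U) = frob A.
Proof.
move=> /unitarymxP UU.
by rewrite /frob trmxCM mulmxA -(mulmxA A) UU mulmx1.
Qed.

Lemma frob_mulUl m n (A : 'M[C]_(m, n)) (U : 'M[C]_m) :
  U \is unitarymx -> frob (U *m A) = frob A.
Proof.
by move=> Uu; rewrite -frob_trmxC trmxCM frob_mulUr ?trmxC_unitary// frob_trmxC.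
Qed.

(** By the parallelogram identity the two sides differ by [frob (A - B)]. The factor 2 is the price
    of working with squared norms. *)
Lemma frobD_le m n (A B : 'M[C]_(m, n)) : frob (A + B) <= 2 * frob A + 2 * frob B.
Proof.
rewrite !frobE !mulr_sumr -big_split /=; apply: ler_sum => i _.
rewrite !mulr_sumr -big_split /=; apply: ler_sum => j _.
rewrite mxE -subr_ge0.
have -> : 2 * `|A i j| ^+ 2 + 2 * `|B i j| ^+ 2 - `|A i j + B i j| ^+ 2 =
          `|A i j - B i j| ^+ 2.
  rewrite !normCK !rmorphB !rmorphD /=.
  ring.
exact: exprn_ge0.
Qed.

(** Cauchy-Schwarz, applied to each entry as the inner product of a row of [A] with a conjugated
    column of [B]. *)
Lemma frobM_le m n p (A : 'M[C]_(m, n)) (B : 'M[C]_(n, p)) :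
  frob (A *m B) <= frob A * frob B.
Proof.
rewrite -[frob B]frob_trmxC !frobE mulr_suml; apply: ler_sum => i _.
rewrite mulr_sumr; apply: ler_sum => j _.
pose u : 'rV[C]_n := row i A; pose v : 'rV[C]_n := row j (B^t*).
have -> : (A *m B) i j = dotmx u v.
  rewrite dotmxE !mxE; apply: eq_bigr => k _.
  by rewrite !mxE conjCK.
have Euu (w : 'rV[C]_n) : \sum_k `|w 0 k| ^+ 2 = dotmx w w.
  by rewrite dotmxE mxE; apply: eq_bigr => k _; rewrite !mxE normCK.
have -> : \sum_j0 `|A i j0| ^+ 2 = dotmx u u.
  by rewrite -Euu; apply: eq_bigr => k _; rewrite mxE.
have -> : \sum_j0 `|(B^t*) j j0| ^+ 2 = dotmx v v.
  by rewrite -Euu; apply: eq_bigr => k _; rewrite [in RHS]mxE.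
by have [] := CauchySchwarz (@dotmx C n) u v.
Qed.

Lemma trmxCKl n (A : 'M[C]_n) : A \is unitarymx -> A^t* *m A = 1%:M.
Proof. by rewrite -trmxC_unitary => /unitarymxP; rewrite trmxCK. Qed.

Lemma frob_unitaryB n (A B : 'M[C]_n) : A \is unitarymx -> B \is unitarymx ->
  frob (A - B) = n%:R + n%:R - (\tr (A^t* *m B) + (\tr (A^t* *m B))^*).
Proof.
move=> /unitarymxP AA /unitarymxP BB.
rewrite /frob trmxCB mulmxBl !mulmxBr AA BB !raddfB /= mxtrace1.
rewrite -mxtrace_trmxC trmxCM trmxCK (mxtrace_mulC (A^t*)).
rewrite (mxtrace_mulC (B^t*)); ring.
Qed.

Lemma frob_unitaryB1 n (A B : 'M[C]_n) : A \is unitarymx -> B \is unitarymx ->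
  frob (A^t* *m B - 1%:M) = frob (A - B).
Proof.
move=> uA uB; have uA' : A^t* \is unitarymx by rewrite trmxC_unitary.
rewrite frobBC -[RHS](frob_mulUl _ uA') mulmxBr.
by rewrite (trmxCKl uA).
Qed.

(* The identity behind the proof: conjugating T by the commutator [S, T] moves
   it away from S by an amount controlled by how badly S and T commute. *)
Lemma frob_conj_commutator n (S T : 'M[C]_n) (h := S *m T *m S^t* *m T^t*) :
  S \is unitarymx -> T \is unitarymx -> frob (S - T) <= 1 ->
  frob (S *m T - T *m S) + frob (S - T) <= frob (S - h *m T *m h^t*).
Proof.
move=> uS uT le1.
have uS' : S^t* \is unitarymx by rewrite trmxC_unitary.
have uT' : T^t* \is unitarymx by rewrite trmxC_unitary.
have uh : h \is unitarymx by rewrite !mul_unitarymx.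
have /unitarymxP SS := uS; have /unitarymxP TT := uT.
have SS' := trmxCKl uS; have TT' := trmxCKl uT.
(* Since [S Y T = S T - T S], the defect [Y] has the norm of the commutator, while being [1] minus a
   unitary matrix. *)
pose W := S^t* *m T; pose V := S *m T^t*; pose Y := 1%:M - W *m V.
have uW : W \is unitarymx by rewrite mul_unitarymx.
have uWV : W *m V \is unitarymx by rewrite !mul_unitarymx.
have /unitarymxP WW := uW; have /unitarymxP WVWV := uWV.
have frobY : frob Y = frob (S *m T - T *m S).
  rewrite -[LHS](frob_mulUl _ uS) -[LHS](frob_mulUr _ uT) /Y /W /V.
  rewrite mulmxBr mulmxBl mulmx1 !mulmxA SS mul1mx.
  by rewrite -!mulmxA TT' mulmx1.
(* If [X = 1 - U] with [U] unitary, then [X + X^* = X X^*]. This serves here for [Y] and in the next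
   step for [1 - W]. *)
have YY : Y + Y^t* = Y *m Y^t*.
  rewrite /Y trmxCB trmxC1 mulmxBl !mulmxBr WVWV !mulmx1 !mul1mx.
  by move: (W *m V) => M; apply/matrixP => i j; rewrite !mxE; ring.
have WWE : W + W^t* = 1%:M + 1%:M - (W - 1%:M) *m (W - 1%:M)^t*.
  rewrite trmxCB trmxC1 mulmxBl !mulmxBr WW !mulmx1 !mul1mx.
  by apply/matrixP => i j; rewrite !mxE; ring.
(* [W^* Y = W^* - V], a difference of matrices of equal trace. Adding this zero to the trace of
   [W Y] brings in [W + W^*]. *)
have trWY : \tr (W^t* *m Y) = 0.
  rewrite /Y mulmxBr mulmx1 raddfB /= mulmxA (trmxCKl uW).
  by rewrite mul1mx /W trmxCM trmxCK /V mxtrace_mulC subrr.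
pose Z := W - 1%:M.
have frobZ : frob Z = frob (S - T) by exact: frob_unitaryB1.
have trWYE : \tr (W *m Y) = 2 * \tr Y - \tr (Z *m Z^t* *m Y).
  rewrite -[LHS]addr0 -trWY -raddfD -mulmxDl WWE mulmxBl mulmxDl mul1mx.
  by rewrite raddfB raddfD /=; ring.
have trYE : \tr Y + (\tr Y)^* = frob Y by rewrite -mxtrace_trmxC -raddfD YY.
have trZZYE : \tr (Z *m Z^t* *m Y) + (\tr (Z *m Z^t* *m Y))^* = frob (Z^t* *m Y).
  have -> : \tr (Z *m Z^t* *m Y) = \tr (Z^t* *m Y *m Z).
    by rewrite -mulmxA mxtrace_mulC.
  rewrite -mxtrace_trmxC !trmxCM trmxCK -raddfD mulmxA -mulmxDl -mulmxDr YY.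
  by rewrite /frob trmxCM trmxCK !mulmxA.
have trE : \tr (S^t* *m (h *m T *m h^t*)) = \tr W - \tr (W *m Y).
  rewrite -raddfB /Y mulmxBr mulmx1 opprB addrC subrK.
  rewrite /h !trmxCM !trmxCK !mulmxA SS' mul1mx -(mulmxA _ (T^t*) T) TT' mulmx1.
  by rewrite mxtrace_mulC /W /V !mulmxA.
rewrite -subr_ge0 -frobY (frob_unitaryB uS uT).
rewrite (@frob_unitaryB _ S) ?mul_unitarymx ?trmxC_unitary // trE.
rewrite -/W rmorphB /= trWYE rmorphB rmorphM rmorph_nat /=.
(* This is where [frob (S - T) <= 1] is used: the correction term cannot exceed [frob Y]. *)
have le : frob (Z^t* *m Y) <= frob Y.
  apply: le_trans (frobM_le _ _) _; rewrite frob_trmxC frobZ.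
  by rewrite ler_piMl ?frob_ge0.
set y := \tr Y in trYE *; set z := \tr (Z *m Z^t* *m Y) in trZZYE *; set w := \tr W.
(* The exact formula: the squared distance to [S] grows by [2 * frob Y - frob (Z^t* *m Y)]. *)
suff -> : n%:R + n%:R - (w - (2 * y - z) + (w^* - (2 * y^* - z^*))) -
  (frob Y + (n%:R + n%:R - (w + w^*))) = frob Y - frob (Z^t* *m Y).
  by rewrite subr_ge0.
by rewrite -trYE -trZZYE; ring.
Qed.

End Frobenius.

(** * Powers, eigenvalues and perturbation of unitary matrices *)

Section UnitarySpectrum.
Local Open Scope sesquilinear_scope.
Variable C : numClosedFieldType.
Implicit Type n : nat.

Lemma unitarymxX n (A : 'M[C]_n) k : A \is unitarymx -> A ^+ k \is unitarymx.
Proof.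
move=> uA; elim: k => [|k IHk].
  by rewrite expr0; apply/unitarymxP; rewrite trmxC1 mulmx1.
by rewrite exprS mul_unitarymx.
Qed.

Lemma trmxCX n (A : 'M[C]_n) k : (A ^+ k)^t* = (A^t*) ^+ k.
Proof.
elim: k => [|k IHk]; first by rewrite !expr0; exact: trmxC1.
by rewrite exprS exprSr -IHk; exact: trmxCM.
Qed.

Lemma conj_exp n (g A : 'M[C]_n) k : g \is unitarymx ->
  (g *m A *m g^t*) ^+ k = g *m A ^+ k *m g^t*.
Proof.
move=> ug; elim: k => [|k IHk].
  by rewrite !expr0; move/unitarymxP: ug => gg; rewrite mulmx1 gg.
by rewrite exprS IHk -mulmxE !mulmxA -(mulmxA _ (g^t*) g) trmxCKl// mulmx1
  exprS -mulmxE !mulmxA.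
Qed.

(** Induction on [[A^(k+1), B] = A [A^k, B] + [A, B] A^k]: each step doubles the previous bound and
    adds at most as much again. *)
Lemma frob_commX n (A B : 'M[C]_n) k : A \is unitarymx -> B \is unitarymx ->
  frob (A ^+ k * B - B * A ^+ k) <= 4 ^+ k * frob (A * B - B * A).
Proof.
move=> uA uB; elim: k => [|k IHk].
  rewrite !expr0 !mul1r mulr1 subrr.
  by apply: le_trans (frob_ge0 _); rewrite /frob mul0mx mxtrace0.
have -> : A ^+ k.+1 * B - B * A ^+ k.+1 =
    A *m (A ^+ k * B - B * A ^+ k) + (A * B - B * A) *m A ^+ k.
  rewrite !mulmxE mulrBr mulrBl !mulrA -exprS addrA subrK.
  by rewrite -!mulrA -exprS.
apply: le_trans (frobD_le _ _) _.
rewrite frob_mulUl// frob_mulUr ?unitarymxX//.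
set e := frob (A * B - B * A).
have e0 : 0 <= e by exact: frob_ge0.
have le1 : e <= 4 ^+ k * e by rewrite ler_peMl// exprn_ege1// ler1n.
have -> : 4 ^+ k.+1 * e = 2 * (4 ^+ k * e) + 2 * (4 ^+ k * e) by rewrite exprS; ring.
by rewrite lerD// ler_wpM2l.
Qed.

(** Each induction step splits off one commutator [[A^k, B]], controlled by [frob_commX].
    Exponential growth in [k] is harmless, as [k] will be bounded before the commutator is made
    small. *)
Lemma frob_mulX n (A B : 'M[C]_n) k : A \is unitarymx -> B \is unitarymx ->
  frob (A ^+ k * B ^+ k - (A * B) ^+ k) <= 8 ^+ k * frob (A * B - B * A).
Proof.
move=> uA uB; elim: k => [|k IHk].
  rewrite !expr0 !mul1r subrr.
  by apply: le_trans (frob_ge0 _); rewrite /frob mul0mx mxtrace0.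
have -> : A ^+ k.+1 * B ^+ k.+1 - (A * B) ^+ k.+1 =
    A *m (A ^+ k * B - B * A ^+ k) *m B ^+ k +
    (A *m B) *m (A ^+ k * B ^+ k - (A * B) ^+ k).
  rewrite !mulmxE !mulrBr !mulrBl !exprS !mulrA addrA.
  by rewrite subrK.
apply: le_trans (frobD_le _ _) _.
rewrite frob_mulUr ?unitarymxX// frob_mulUl// (frob_mulUl _ (mul_unitarymx uA uB)).
have h1 := frob_commX k uA uB.
set e := frob (A * B - B * A) in IHk h1 *.
have e0 : 0 <= e by exact: frob_ge0.
have h2 : 4 ^+ k * e <= 8 ^+ k * e.
  by rewrite ler_wpM2r// lerXn2r ?nnegrE ?ler_nat ?ler0n.
have h3 : 0 <= 8 ^+ k * e by rewrite mulr_ge0// exprn_ge0.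
apply: (@le_trans _ _ (2 * (8 ^+ k * e) + 2 * (8 ^+ k * e))).
  by rewrite lerD// ler_wpM2l//; apply: le_trans h1 h2.
have -> : 8 ^+ k.+1 * e = 2 * (8 ^+ k * e) + 2 * (8 ^+ k * e) + 4 * (8 ^+ k * e).
  by rewrite exprS; ring.
by rewrite lerDl mulr_ge0.
Qed.

Lemma unitarymx_diag n (A : 'M[C]_n) : A \is unitarymx ->
  exists U (d : 'rV[C]_n), U \is unitarymx /\ A = U^t* *m diag_mx d *m U.
Proof.
move=> uA; have nA : A \is normalmx.
  by apply/normalmxP; rewrite (trmxCKl uA); apply/unitarymxP.
exists (spectralmx A), (spectral_diag A); split; first exact: spectral_unitarymx.
by rewrite -(invmx_unitary (spectral_unitarymx A)); apply/orthomx_spectralP.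
Qed.

Lemma eigenvalue_diag n (U : 'M[C]_n) (d : 'rV[C]_n) i : U \is unitarymx ->
  eigenvalue (U^t* *m diag_mx d *m U) (d 0 i).
Proof.
move=> uU; apply/eigenvalueP; exists (row i U).
  rewrite -row_mul !mulmxA; move/unitarymxP: (uU) => ->.
  by rewrite mul1mx mul_diag_mx; apply/rowP => j; rewrite !mxE.
apply/negP => /eqP U0; have /row_unitarymxP/(_ i i) := uU.
rewrite U0 eqxx dotmxE mul0mx mxE => /eqP.
by rewrite eq_sym oner_eq0.
Qed.

Lemma frob_diag_row n (w d : 'rV[C]_n) :
  frob (w *m diag_mx d) = \sum_i `|w 0 i| ^+ 2 * `|d 0 i| ^+ 2.
Proof.
rewrite frobE big_ord1 mul_mx_diag; apply: eq_bigr => i _.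
by rewrite mxE normrM exprMn.
Qed.

(* A weighted average of the values [`|d_i|^2] is at most [e], hence so is one of them. *)
Lemma frob_diag_row_min n (w d : 'rV[C]_n) e : 0 <= e -> w != 0 ->
  frob (w *m diag_mx d) <= e * frob w -> exists i, `|d 0 i| ^+ 2 <= e.
Proof.
move=> e0 w0; rewrite frob_diag_row frobE big_ord1 mulr_sumr => le.
have [i wi] : exists i, w 0 i != 0.
  apply/existsP; apply: contraNT w0 => /existsPn w0.
  by apply/eqP/rowP => i; rewrite mxE; apply/eqP; rewrite -[_ == _]negbK w0.
have e_real : e \is Num.real by exact: ger0_real.
apply/existsP; apply: contraT => /existsPn H; suff: false by [].
rewrite -(ltxx (\sum_i e * `|w 0 i| ^+ 2)); apply: lt_le_trans le.
have cmp j : `|w 0 j| ^+ 2 * e <= `|w 0 j| ^+ 2 * `|d 0 j| ^+ 2.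
  apply: ler_wpM2l; rewrite ?exprn_ge0//.
  by rewrite ltW// real_ltNge ?H// ger0_real ?exprn_ge0.
rewrite (bigD1 i)//= [ltRHS](bigD1 i)//=; apply: ltr_leD.
  rewrite mulrC ltr_pM2l ?exprn_gt0 ?normr_gt0//.
  by rewrite real_ltNge ?H// ger0_real ?exprn_ge0.
by apply: ler_sum => j _; rewrite mulrC.
Qed.

(* Bauer-Fike. *)
Lemma eigenvalue_near n (A B : 'M[C]_n) b : A \is unitarymx -> eigenvalue B b ->
  exists2 a, eigenvalue A a & `|a - b| ^+ 2 <= frob (A - B).
Proof.
move=> /unitarymx_diag[U [d [uU ->]]] /eigenvalueP[v vB v0].
set A0 := _ *m U.
have uU' : U^t* \is unitarymx by rewrite trmxC_unitary.
have UU := trmxCKl uU.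
pose w := v *m U^t*.
have w0 : w != 0.
  apply: contra v0 => /eqP w0.
  by rewrite -(mulmx1 v) -UU mulmxA -/w w0 mul0mx.
have [|i le] := @frob_diag_row_min _ w (d - const_mx b) (frob (A0 - B)) (frob_ge0 _) w0; last first.
  exists (d 0 i); first exact: eigenvalue_diag.
  by move: le; rewrite !mxE.
have <- : frob v = frob w by rewrite frob_mulUr.
have -> : frob (w *m diag_mx (d - const_mx b)) = frob (v *m (A0 - B)).
  rewrite -(frob_mulUr _ uU); congr frob.
  rewrite mulmxBr vB /A0 !mulmxA -/w raddfB /= mulmxBr mulmxBl.
  rewrite diag_const_mx mul_mx_scalar -scalemxAl.
  by rewrite /w -[v *m _ *m U]mulmxA UU mulmx1.
by rewrite mulrC frobM_le.
Qed.

(** In an eigenbasis [frob (A - 1)] is the sum of the squares [|d_i - 1|^2], and some term is at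
    least their average. This yields an eigenvalue close to 1 yet quantitatively away from it. *)
Lemma eigenvalue_far n (A : 'M[C]_n.+1) : A \is unitarymx ->
  exists a, [/\ eigenvalue A a, `|a - 1| ^+ 2 <= frob (A - 1%:M) &
                frob (A - 1%:M) <= n.+1%:R * `|a - 1| ^+ 2].
Proof.
move=> /unitarymx_diag[U [d [uU ->]]].
have uU' : U^t* \is unitarymx by rewrite trmxC_unitary.
have UU := trmxCKl uU.
have -> : frob (U^t* *m diag_mx d *m U - 1%:M) = \sum_i `|d 0 i - 1| ^+ 2.
  rewrite -UU -mulmxBl -{2}(mulmx1 (U^t*)) -mulmxBr frob_mulUr// frob_mulUl// frobE.
  apply: eq_bigr => i _; rewrite (bigD1 i)//= big1 ?addr0 => [|j ji].
    by rewrite !mxE eqxx.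
  by rewrite !mxE eq_sym (negbTE ji) subrr normr0 expr0n.
have ge0 i : 0 <= `|d 0 i - 1| ^+ 2 by rewrite exprn_ge0.
have single i : `|d 0 i - 1| ^+ 2 <= \sum_i `|d 0 i - 1| ^+ 2.
  by rewrite (bigD1 i)//= lerDl sumr_ge0.
suff [i le] : exists i, \sum_i `|d 0 i - 1| ^+ 2 <= n.+1%:R * `|d 0 i - 1| ^+ 2.
  by exists (d 0 i); split=> //; exact: eigenvalue_diag.
apply/existsP; apply: contraT => /existsPn H; suff: false by [].
set s := \sum_i _ in H *.
have s_real : s \is Num.real by rewrite ger0_real ?sumr_ge0.
have lt i : n.+1%:R * `|d 0 i - 1| ^+ 2 < s.
  by rewrite real_ltNge ?H// ger0_real ?mulr_ge0.
have : \sum_(i < n.+1) (n.+1%:R * `|d 0 i - 1| ^+ 2) < \sum_(i < n.+1) s.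
  by apply: ltr_sum => //; apply/hasP; exists ord0; rewrite ?mem_index_enum.
by rewrite -mulr_sumr -/s sumr_const card_ord mulr_natl ltxx.
Qed.

Lemma eigenvalue_unitary_norm n (A : 'M[C]_n) a :
  A \is unitarymx -> eigenvalue A a -> `|a| = 1.
Proof.
move=> uA /eigenvalueP[v vA v0].
have := frob_mulUr v uA; rewrite vA.
have -> : frob (a *: v) = `|a| ^+ 2 * frob v.
  rewrite !frobE mulr_sumr; apply: eq_bigr => i _.
  by rewrite mulr_sumr; apply: eq_bigr => j _; rewrite mxE normrM exprMn.
have fv0 : frob v != 0 by apply: contra v0 => /eqP/frob_eq0 ->.
rewrite -[RHS]mul1r => /(mulIf fv0) /eqP.
by rewrite sqrf_eq1 => /orP[/eqP|/eqP a1] //; have := normr_ge0 a; rewrite a1 oppr_ge0 ler10.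
Qed.

(** Indexing by ['I_n], repetitions allowed, is what later bounds the number of ratios of
    eigenvalues. *)
Lemma eigenvalue_enum n (A : 'M[C]_n) : A \is unitarymx ->
  exists d : 'I_n -> C, (forall i, eigenvalue A (d i)) /\
    forall a, eigenvalue A a -> exists i, a = d i.
Proof.
move=> uA; have /unitarymx_diag[U [d [uU AE]]] := uA; exists (d 0); split => [i|a ea].
  by rewrite AE eigenvalue_diag.
have uU' : U^t* \is unitarymx by rewrite trmxC_unitary.
have UU := trmxCKl uU.
have /eigenvalueP[v vA v0] := ea; pose w := v *m U^t*.
have /rV0Pn[i wi] : w != 0.
  apply: contra v0 => /eqP w0.
  by rewrite -(mulmx1 v) -UU mulmxA -/w w0 mul0mx.
exists i; have : w *m diag_mx d = a *: w.
  have /(congr1 (mulmx^~ (U^t*))) := vA.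
  rewrite AE -scalemxAl -/w !mulmxA -/w -(mulmxA _ U).
  by move/unitarymxP: (uU) => ->; rewrite mulmx1.
move/rowP/(_ i); rewrite mul_mx_diag !mxE mulrC => E.
by apply/esym/(mulIf wi); rewrite mxE.
Qed.

Lemma eigenvalueX n (A : 'M[C]_n) a k : eigenvalue A a -> eigenvalue (A ^+ k) (a ^+ k).
Proof.
move=> /eigenvalueP[v vA v0]; apply/eigenvalueP; exists v => //.
elim: k => [|k IHk]; first by rewrite !expr0 scale1r mulmx1.
by rewrite exprS mulmxA vA -scalemxAl IHk scalerA -exprS.
Qed.

Lemma eigenvalue_trmxC n (A : 'M[C]_n) b :
  A \is unitarymx -> eigenvalue (A^t*) b -> eigenvalue A b^-1.
Proof.
move=> uA eb; have /eigenvalueP[v vA v0] := eb.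
have b0 : b != 0.
  by rewrite -normr_eq0 (eigenvalue_unitary_norm _ eb) ?trmxC_unitary// oner_eq0.
apply/eigenvalueP; exists v => //.
apply: (@scalerI _ _ b) => //; rewrite scalerA divff// scale1r.
by rewrite scalemxAl -vA -mulmxA (trmxCKl uA) mulmx1.
Qed.

Lemma eigenvalue_conj n (U A : 'M[C]_n) a :
  U \is unitarymx -> eigenvalue (U *m A *m U^t*) a -> eigenvalue A a.
Proof.
move=> uU /eigenvalueP[v vA v0]; apply/eigenvalueP; exists (v *m U).
  by rewrite scalemxAl -vA -!mulmxA trmxCKl// mulmx1.
apply: contra v0 => /eqP vU0; move/unitarymxP: uU => UU.
by rewrite -(mulmx1 v) -UU mulmxA vU0 mul0mx.
Qed.

End UnitarySpectrum.

(** * Rotations and arcs *)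

(* Pigeonhole on the [2 q^2] sample points [j / (2 q^2)]: an arc of half-length about
   [1 / (2 q)] contains at most [2 q + 1] of them, and [(q - 1) (2 q + 1) < 2 q^2]. *)
Lemma arcs_not_cover (R : realType) (q K : nat) (I : finType) (b : I -> R) (r t : R) :
  (#|I| < q)%N -> 0 < t -> 1 <= K%:R * t ->
  (2 * q ^ 2)%:R * (r + t) < q%:R + 2^-1 ->
  ~ (forall k, (k <= K)%N -> exists i (m : int), `|k%:R * t - b i - m%:~R| <= r).
Proof.
move=> Iq t0 Kt rt cov.
have q0 : (0 < q)%N by case: q Iq {rt}.
pose Q := (2 * q ^ 2)%N; have Q0 : 0 < Q%:R :> R by rewrite ltr0n /Q muln_gt0 expn_gt0 q0.
have sample (j : 'I_Q) : exists im : I * int,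
    `|j%:R - Q%:R * b im.1 - Q%:R * im.2%:~R| < q%:R + 2^-1.
  (* With [k] the truncation of [x / t], the point [k t] is the last one not beyond the sample [x];
     an arc holding [k t], widened by [t], holds [x]. *)
  pose x : R := j%:R / Q%:R.
  have x0 : 0 <= x / t by rewrite !divr_ge0// ltW.
  have /andP[k1 k2] := truncn_itv x0.
  set k := Num.truncn _ in k1 k2.
  have kx : k%:R * t <= x by rewrite -ler_pdivlMr.
  have xk : x < k%:R * t + t by move: k2; rewrite ltr_pdivrMr// -natr1 mulrDl mul1r.
  have x1 : x < 1 by rewrite ltr_pdivrMr// mul1r ltr_nat ltn_ord.
  have kK : (k <= K)%N.
    rewrite -(ler_nat R) -(ler_pM2r t0); apply: le_trans kx _.
    by apply: le_trans (ltW x1) _.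
  have [i [m im]] := cov k kK; exists (i, m) => /=.
  apply: le_lt_trans rt; rewrite -/Q.
  have -> : j%:R - Q%:R * b i - Q%:R * m%:~R = Q%:R * (x - b i - m%:~R).
    by rewrite /x; field; rewrite gt_eqF.
  rewrite normrM gtr0_norm// ler_pM2l//.
  move: im; rewrite !ler_norml => /andP[? ?]; apply/andP; split; lra.
have [f fP] := choice sample.
(* Samples sharing the same [b i] have values of [z] less than [2 q + 1 = D] apart, so [z] modulo
   [D] determines [z], which determines [j] modulo [Q]. *)
pose z (j : 'I_Q) : int := j%:Z - Q%:Z * (f j).2.
pose D := (2 * q).+1.
pose F (j : 'I_Q) : I * 'I_D := ((f j).1, inord `|(z j %% D%:Z)%Z|).
have Finj : injective F.
  move=> j j' [fjj' /(congr1 val)]/=.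
  have lt (y : int) : (`|(y %% D)%Z| < D)%N.
    by rewrite -ltz_nat gez0_abs ?modz_ge0// ltz_pmod.
  rewrite !inordK// => /(congr1 Posz); rewrite !gez0_abs ?modz_ge0// => zz.
  have zlt : (`|z j - z j'| < D)%N.
    rewrite -ltz_nat -(ltr_int R) abszE intr_norm.
    have := fP j; have := fP j'; rewrite -fjj' !ltr_norml => /andP[h1 h2] /andP[h3 h4].
    rewrite /z !rmorphB !rmorphM /= -!pmulrn /D.
    rewrite -natr1 natrM.
    move: h1 h2 h3 h4; set u := Q%:R * b _; set u1 := Q%:R * _; set u2 := Q%:R * _ => *.
    by apply/andP; split; lra.
  have zE : z j = z j'.
    apply/eqP; rewrite -subr_eq0 -absz_eq0; apply: contraT => nz.
    have : (D%:Z %| z j - z j')%Z by rewrite -eqz_mod_dvd zz.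
    by rewrite dvdzE => /dvdn_leq; rewrite lt0n nz /= leqNgt zlt => /(_ isT).
  have : (j%:Z = j' %[mod Q%:Z])%Z.
    have -> : j%:Z = (f j).2 * Q%:Z + z j by rewrite /z mulrC addrC subrK.
    have -> : j'%:Z = (f j').2 * Q%:Z + z j' by rewrite /z mulrC addrC subrK.
    by rewrite !modzMDl zE.
  rewrite !modz_small ?ltz_nat ?ltn_ord// => -[].
  exact: val_inj.
have := leq_card F Finj; rewrite card_prod !card_ord leqNgt => /negP; apply.
apply: (@leq_ltn_trans (q.-1 * D)); first by rewrite leq_mul2r -ltnS prednK// Iq orbT.
rewrite /D /Q; case: (q) q0 => // p _ /=; nia.
Qed.

Section Circle.
Variable R : realType.
Implicit Types (x y t : R) (z w : R[i]).

Definition cis t : R[i] := (cos t +i* sin t)%C.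

Lemma cisD x y : cis (x + y) = cis x * cis y.
Proof.
by apply/eqP; rewrite eq_complex /= cosD sinD eqxx /= addrC mulrC.
Qed.

Lemma cis0 : cis 0 = 1.
Proof. by rewrite /cis cos0 sin0. Qed.

Lemma cisN x : cis (- x) = (cis x)^-1.
Proof.
have h : cis (- x) * cis x = 1 by rewrite -cisD addNr cis0.
have n0 : cis x != 0.
  by apply/eqP => E; move: h; rewrite E mulr0 => /eqP; rewrite eq_sym oner_eq0.
by apply: (mulIf n0); rewrite h mulVf.
Qed.

Lemma cisB x y : cis (x - y) = cis x / cis y.
Proof. by rewrite cisD cisN. Qed.

Lemma cisX x k : cis x ^+ k = cis (k%:R * x).
Proof.
elim: k => [|k IHk]; first by rewrite mul0r cis0.
by rewrite exprS IHk -cisD -natr1 mulrDl mul1r addrC.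
Qed.

Lemma cis_period (m : int) : cis (m%:~R * (2 * pi)) = 1.
Proof.
have cis2pi : cis (2 * pi) = 1.
  by rewrite /cis mulr_natl cos2pi sin2pi.
case: m => k; first by rewrite -pmulrn -cisX cis2pi expr1n.
by rewrite NegzE mulrNz mulNr cisN -pmulrn -cisX cis2pi expr1n invr1.
Qed.

Lemma norm_cis x : `|cis x| = 1.
Proof. by rewrite normc_def /= cos2Dsin2 sqrtr1. Qed.

Lemma cos_norm x : cos `|x| = cos x.
Proof. by case: (ger0P x) => // _; rewrite cosN. Qed.

Lemma cis_eq1 x : `|x| <= pi -> cis x = 1 -> x = 0.
Proof.
move=> xpi [cx _]; apply/eqP; rewrite -normr_eq0; apply/eqP.
by apply: cos_inj; rewrite ?in_itv /= ?normr_ge0 ?lexx ?pi_ge0// cos0 cos_norm.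
Qed.

Lemma cis_inj x y : cis x = cis y -> exists m : int, x = y + m%:~R * (2 * pi).
Proof.
move=> xy; have pi0 := pi_gt0 R.
(* Adding one half makes [m] a nearest integer, so the remainder has absolute value at most [pi]. *)
pose m := Num.floor ((x - y) / (2 * pi) + 2^-1); exists m.
have /andP[m1 m2] := floor_itv ((x - y) / (2 * pi) + 2^-1).
apply/eqP; rewrite -subr_eq0 opprD addrA; apply/eqP/cis_eq1; last first.
  by rewrite !cisB xy cis_period divr1 divff// -normr_eq0 norm_cis oner_eq0.
have E : (x - y) / (2 * pi) * (2 * pi) = x - y by rewrite divfK// gt_eqF// mulr_gt0.
move: m1 m2 E; rewrite -/m intrD; set u := _ / _; set v := m%:~R => m1 m2 <-.
by rewrite ler_norml; apply/andP; split; nra.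
Qed.

Lemma unit_cis z : `|z| = 1 -> exists t, -pi < t <= pi /\ z = cis t.
Proof.
case: z => a b; rewrite normc_def /= => -[] E.
have {}E : a ^+ 2 + b ^+ 2 = 1.
  by rewrite -(sqr_sqrtr (addr_ge0 (sqr_ge0 a) (sqr_ge0 b))) E expr1n.
have a1 : -1 <= a <= 1 by apply/andP; split; nra.
have ca : cos (acos a) = a by rewrite acosK// in_itv.
have sa : sin (acos a) = `|b|.
  by rewrite sin_acos// -E addrAC subrr add0r sqrtr_sqr.
have a0 := acos_ge0 a1; have api := acos_lepi a1; have pi0 := pi_gt0 R.
have [b0|b0] := leP 0 b.
  exists (acos a); split; first by rewrite api andbT; lra.
  by rewrite /cis ca sa ger0_norm.
exists (- acos a); split.
  (* The lower bound [- pi] is strict; [acos a = pi] would force [b = 0]. *)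
  suff : acos a != pi by move=> /eqP ?; apply/andP; split; lra.
  by apply/eqP => aE; move: sa; rewrite aE sinpi ltr0_norm//; lra.
by rewrite /cis cosN sinN ca sa ltr0_norm// opprK.
Qed.

Lemma cis_arg z : `|z| = 1 -> z = cis (arg z) /\ `|arg z| <= pi.
Proof.
move=> z1; have [t [tpi zt]] := unit_cis z1.
have : is_principal_arg z (arg z).
  by rewrite /arg; apply: xgetPex; exists t; split=> //; rewrite z1 mul1r.
move=> [/andP[h1 h2] E]; split; first by rewrite {1}E z1 mul1r.
by rewrite ler_norml ltW.
Qed.

Lemma norm_cisB1 t : `|cis t - 1| ^+ 2 = (2 - 2 * cos t)%:C%C.
Proof.
rewrite -add_Re2_Im2 /= subr0; congr (_ %:C)%C.
by have := cos2Dsin2 t; lra.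
Qed.

(** The squared chord [2 - 2 cos t] increases with [|t|] up to [pi], so bounds on chords become
    bounds on angles. *)
Lemma cis_near t x : `|t| <= pi -> 0 <= x <= pi ->
  `|cis t - 1| ^+ 2 < (2 - 2 * cos x)%:C%C -> `|t| < x.
Proof.
move=> tpi xpi; rewrite norm_cisB1 ltcR => h.
by rewrite -ltr_cos ?in_itv /= ?normr_ge0// cos_norm; lra.
Qed.

Lemma cis_far t x : `|t| <= pi -> 0 <= x <= pi ->
  (2 - 2 * cos x)%:C%C <= `|cis t - 1| ^+ 2 -> x <= `|t|.
Proof.
move=> tpi xpi h; rewrite leNgt; apply/negP => tx.
have : cos x < cos `|t| by rewrite ltr_cos ?in_itv /= ?normr_ge0.
by move: h; rewrite norm_cisB1 lecR cos_norm; lra.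
Qed.

(** The order of choices matters: [e] depends on [q] alone and [K] on [q] and [l0], so
    approximations can be refined once [K] is known. Measured in turns, this is [arcs_not_cover]
    with arcs enlarged to absorb the gap between [z] and [l ^+ k]. *)
Lemma rotation_escapes (q : nat) : (0 < q)%N ->
  exists2 e : R, 0 < e & forall l0 : R, 0 < l0 -> exists K : nat,
  forall (I : finType) (p : I -> R[i]) (l : R[i]), (#|I| < q)%N ->
    (forall i, `|p i| = 1) -> `|l| = 1 -> l0%:C%C <= `|l - 1| ^+ 2 < e%:C%C ->
  exists2 k, (k <= K)%N & forall i z, `|z| = 1 -> `|z - l ^+ k| ^+ 2 < e%:C%C ->
    pi / q%:R < `|arg (p i / z)|.
Proof.
move=> q0; have pi0 := pi_gt0 R; have qr0 : 0 < q%:R :> R by rewrite ltr0n.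
have q1 : 1 <= q%:R :> R by rewrite ler1n.
(* As [|th| < x] will hold, [q^2 x = pi / 4] keeps [q^2 (x + |th|) / pi] below the slack [1/2] of
   [arcs_not_cover]. *)
pose x : R := pi / (4 * q%:R ^+ 2).
have qq0 : 0 < 4 * q%:R ^+ 2 :> R by rewrite mulr_gt0// exprn_gt0.
have x0 : 0 < x by rewrite divr_gt0.
have xpi : x <= pi by rewrite ler_pdivrMr// ler_peMr ?ltW//; nra.
exists (2 - 2 * cos x).
  have : cos x < cos 0 by rewrite ltr_cos ?in_itv /= ?lexx ?(ltW x0) ?(ltW pi0).
  by rewrite cos0; lra.
(* The cap 2 keeps [1 - l1 / 2] in the domain of [acos]; [x1] is the angle with squared chord
   [l1]. *)
move=> l0 l00; pose l1 := Num.min l0 2.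
have /andP[l10 l12] : 0 < l1 <= 2 by rewrite lt_min l00 ltr0n ge_min lexx orbT.
pose x1 := acos (1 - l1 / 2).
have hc : -1 <= 1 - l1 / 2 < 1 by apply/andP; split; lra.
have hc' : -1 <= 1 - l1 / 2 <= 1 by apply/andP; split; lra.
have x10 : 0 < x1 by exact: acos_gt0.
have x1pi : 0 <= x1 <= pi by rewrite ltW//= acos_lepi.
have cx1 : cos x1 = 1 - l1 / 2 by rewrite /x1 acosK// in_itv.
(* [K] steps of angle at least [x1] make a full turn. *)
pose K := (Num.truncn (2 * pi / x1)).+1.
have Kx : 2 * pi <= K%:R * x1.
  by rewrite -ler_pdivrMr// ltW// truncnS_gt.
exists K => I p l Iq p1 l_1 /andP[l_far l_near].
have [lE argl] := cis_arg l_1; set th := arg l in lE argl.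
have thx : `|th| < x by apply: cis_near => //; rewrite ?(ltW x0) -?lE.
have thx1 : x1 <= `|th|.
  apply: cis_far => //; rewrite -lE; apply: le_trans l_far.
  rewrite lecR cx1; have : l1 <= l0 by rewrite ge_min lexx.
  by lra.
apply: contrapT => cover.
(* A reflection by the sign of [th] provides the positive step that [arcs_not_cover] needs. *)
pose s : R := if 0 <= th then 1 else -1.
have sth : `|th| = s * th.
  by rewrite /s; case: ger0P => _; rewrite ?mul1r ?mulN1r.
have sN y : `|s * y| = `|y|.
  by rewrite /s; case: ifP => _; rewrite ?mul1r ?mulN1r ?normrN.
have smi (m : int) : exists m' : int, s * m%:~R = m'%:~R.
  by rewrite /s; case: ifP => _; [exists m|exists (- m)];
     rewrite ?mul1r ?mulN1r ?mulrNz.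
have pi20 : 0 < 2 * pi :> R by rewrite mulr_gt0.
apply: (@arcs_not_cover R q K I (fun i => s * (arg (p i) / (2 * pi)))
   ((pi / q%:R + x) / (2 * pi)) (`|th| / (2 * pi))) => //.
- by rewrite divr_gt0//; lra.
- rewrite mulrA ler_pdivlMr// mul1r; apply: le_trans Kx _.
  by rewrite ler_wpM2l.
- have -> : (2 * q ^ 2)%:R * ((pi / q%:R + x) / (2 * pi) + `|th| / (2 * pi)) =
     q%:R + q%:R ^+ 2 * (x + `|th|) / pi :> R.
    rewrite natrM natrX; move: (@pi R) pi0 => P P0.
    by field; rewrite !gt_eqF.
  rewrite ltrD2l ltr_pdivrMr//.
  have xE : q%:R ^+ 2 * x = pi / 4 :> R.
    rewrite /x; move: (@pi R) => P.
    by field; rewrite gt_eqF.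
  have : q%:R ^+ 2 * `|th| < q%:R ^+ 2 * x by rewrite ltr_pM2l// exprn_gt0.
  by rewrite mulrDr xE; lra.
move=> k kK; apply: contrapT => nocov; apply: cover; exists k => // i z z1 zl.
rewrite ltNge; apply/negP => le; apply: nocov; exists i.
have z0 : z != 0 by rewrite -normr_eq0 z1 oner_eq0.
have [pE _] := cis_arg (p1 i).
have [pzE _] : p i / z = cis (arg (p i / z)) /\ `|arg (p i / z)| <= pi.
  by apply: cis_arg; rewrite normrM normfV p1 z1 divr1.
have [lzE lzpi] : l ^+ k / z = cis (arg (l ^+ k / z)) /\ `|arg (l ^+ k / z)| <= pi.
  by apply: cis_arg; rewrite normrM normfV normrX l_1 z1 expr1n divr1.
have lzx : `|arg (l ^+ k / z)| < x.
  apply: cis_near; rewrite ?(ltW x0) -?lzE// (_ : l ^+ k / z - 1 = (l ^+ k - z) / z).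
    by rewrite normrM normfV z1 divr1 distrC.
  by rewrite mulrBl divff.
set u := arg (l ^+ k / z) in lzE lzx; set v := arg (p i / z) in pzE le.
(* Going from [p i] to [l ^+ k] through [z] takes an angle [v] of size at most [pi / q] and an angle
   [u] of size less than [x]. *)
have : cis (k%:R * th) = cis (arg (p i) - v + u).
  rewrite -cisX -lE cisD cisB -pE -pzE -lzE.
  by field; rewrite z0 -normr_eq0 p1 oner_eq0.
move=> /cis_inj[m E]; have [m' sm] := smi m; exists m'.
rewrite sth -sm.
have -> : k%:R * (s * th / (2 * pi)) - s * (arg (p i) / (2 * pi)) - s * m%:~R =
   s * ((u - v) / (2 * pi)).
  have -> : k%:R * (s * th / (2 * pi)) = s * (k%:R * th) / (2 * pi).
    by move: (2 * pi : R) pi20 => P P0; field; rewrite gt_eqF.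
  by rewrite E; move: (2 * pi : R) pi20 => P P0; field; rewrite gt_eqF.
rewrite sN normrM normfV (gtr0_norm pi20) ler_pM2r ?invr_gt0//.
by apply: le_trans (ler_normB _ _) _; rewrite addrC lerD// ltW.
Qed.

End Circle.

(** * Elements near the identity are central *)

Section ASMGroup.
Local Open Scope sesquilinear_scope.
Variables (R : realType) (n : nat) (G : set 'M[R[i]]_n.+1).

Lemma unitary_unitarymx (A : 'M[R[i]]_n.+1) : unitary A -> A \is unitarymx.
Proof. by move=> uA; apply/unitarymxP; rewrite -[RHS]uA map_trmx. Qed.

Hypothesis Ggrp : unitary_group G.

Lemma unitary_group_unitarymx A : G A -> A \is unitarymx.
Proof. by case: Ggrp => _ _ _ uG /uG/unitary_unitarymx. Qed.

Lemma unitary_groupM A B : G A -> G B -> G (A *m B).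
Proof. by case: Ggrp => _ GM _ _; exact: GM. Qed.

Lemma unitary_group_trmxC A : G A -> G (A^t*).
Proof.
move=> GA; rewrite -(invmx_unitary (unitary_group_unitarymx GA)).
by case: Ggrp => _ _ GV _; exact: GV.
Qed.

Lemma unitary_groupX A k : G A -> G (A ^+ k).
Proof.
move=> GA; elim: k => [|k IHk]; first by rewrite expr0; case: Ggrp.
by rewrite exprS; exact: unitary_groupM.
Qed.

Lemma frob_real (A : 'M[R[i]]_n.+1) : frob A = (complex.Re (frob A))%:C%C.
Proof. by rewrite RRe_real// ger0_real// frob_ge0. Qed.

(* The eigenvalues of [g] and [g^-1] have at most [(n+1)^2 - 1] distinct products, since
   [d_i / d_i = 1] for all [i]. *)
Lemma ASM_power_eigenvalue (S g : 'M[R[i]]_n.+1) : (0 < n)%N ->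
  ASM ((2 * n.+1 ^ 2)%:R^-1 : R) G -> G S -> G g ->
  exists (I : finType) (p : I -> R[i]), [/\ (#|I| < n.+1 ^ 2)%N, forall i, `|p i| = 1 &
    forall k z, eigenvalue (S ^+ k *m ((g *m S *m g^t*)^t*) ^+ k) z ->
      exists i, `|arg (p i / z)| <= pi / (n.+1 ^ 2)%:R].
Proof.
move=> n0 asm GS Gg; have ug := unitary_group_unitarymx Gg.
have [d [dE dP]] := eigenvalue_enum ug.
have d1 i : `|d i| = 1 by exact: eigenvalue_unitary_norm ug (dE i).
have dn0 i : d i != 0 by rewrite -normr_eq0 d1 oner_eq0.
pose I := {x : 'I_n.+1 * 'I_n.+1 | x != (ord0, ord0)}.
exists I, (fun x => d (val x).1 / d (val x).2); split=> [|x|k z].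
- rewrite card_sig; have := cardC1 (ord0 : 'I_n.+1, ord0 : 'I_n.+1).
  by rewrite card_prod card_ord => ->; rewrite mulnn prednK// expn_gt0.
- by rewrite normrM normfV !d1 divr1.
rewrite -trmxCX conj_exp// !trmxCM trmxCK trmxCX.
have -> : S ^+ k *m (g *m ((S^t*) ^+ k *m g^t*)) =
  (S ^+ k *m g *m (S ^+ k)^t*) *m g^t* by rewrite trmxCX !mulmxA.
have GA : G (S ^+ k *m g *m (S ^+ k)^t*).
  have GSk := unitary_groupX k GS.
  exact: unitary_groupM (unitary_groupM GSk Gg) (unitary_group_trmxC GSk).
move=> /(asm _ _ GA (unitary_group_trmxC Gg))[a [b [ea eb ab]]].
have [i iE] := dP _ (eigenvalue_conj (unitary_group_unitarymx (unitary_groupX k GS)) ea).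
have [j jE] := dP _ (eigenvalue_trmxC ug eb).
have abE : a * b = d i / d j by rewrite -iE -jE invrK.
have {}ab : `|arg (d i / d j / z)| <= pi / (n.+1 ^ 2)%:R.
  move: ab; rewrite abE ler_pdivrMr ?mulr_gt0 ?pi_gt0//.
  move/le_trans; apply; rewrite natrM le_eqVlt; apply/orP; left; apply/eqP.
  have : (n.+1 ^ 2)%:R != 0 :> R by rewrite pnatr_eq0 expn_eq0.
  by move: (_ ^ 2)%:R (@pi R) => m P m0; field.
have [E|nE] := eqVneq (i, j) (ord0, ord0); last by exists (Sub (i, j) nE).
(* The pair left out of [I] has ratio 1, which the last diagonal pair also attains; the two differ
   because [0 < n]. *)
have nmax : (ord_max, ord_max) != (ord0, ord0) :> 'I_n.+1 * 'I_n.+1.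
  by apply/eqP => -[/eqP]; rewrite eqn0Ngt n0.
exists (Sub (ord_max, ord_max) nmax) => /=.
by move: ab; case: E => -> ->; rewrite !divff.
Qed.

Lemma frob_conjB_le (S g : 'M[R[i]]_n.+1) : g \is unitarymx ->
  frob (S - g *m S *m g^t*) <= 2 * frob (S - 1%:M) + 2 * frob (S - 1%:M).
Proof.
move=> ug; have ug' : g^t* \is unitarymx by rewrite trmxC_unitary.
have TE : frob (1%:M - g *m S *m g^t*) = frob (S - 1%:M).
  rewrite frobBC -[RHS](frob_mulUl _ ug) -[RHS](frob_mulUr _ ug').
  by rewrite mulmxBr mulmxBl mulmx1; move/unitarymxP: ug => ->.
rewrite -{1}(subrK 1%:M S) -addrA; apply: le_trans (frobD_le _ _) _.
by rewrite TE.
Qed.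

(** [M] is the supremum of the squared distances from [S] to its conjugates, positive thanks to
    [g0]. For a conjugate within [h] of it, [frob_conj_commutator] gives another one farther by the
    squared commutator norm, which is therefore at most [h]. *)
Lemma almost_commuting_conj (S g0 : 'M[R[i]]_n.+1) : G S -> G g0 ->
  S *m g0 <> g0 *m S -> (forall g, G g -> frob (S - g *m S *m g^t*) <= 1) ->
  exists2 M : R, 0 < M & forall h : R, 0 < h -> exists g, [/\ G g,
    (M - h)%:C%C <= frob (S - g *m S *m g^t*) &
    frob (S *m (g *m S *m g^t*) - g *m S *m g^t* *m S) <= h%:C%C].
Proof.
move=> GS Gg0 ncomm le1; have uS := unitary_group_unitarymx GS.
pose f g := complex.Re (frob (S - g *m S *m g^t*)).
have fE g : frob (S - g *m S *m g^t*) = (f g)%:C%C by exact: frob_real.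
clearbody f; pose F := [set f g | g in G]%classic.
have supF : has_sup F.
  split; first by exists (f g0), g0.
  exists 1 => _ [g Gg <-]; have := le1 g Gg.
  by rewrite fE -(rmorph1 (real_complex R)) lecR.
have fM g : G g -> f g <= sup F by move=> Gg; apply: ub_le_sup; [case: supF|exists g].
have adh h : 0 < h -> exists2 g, G g & sup F - h < f g.
  by move=> h0; have [_ [g Gg <-]] := sup_adherent h0 supF; exists g.
move: (sup F) fM adh => {supF}{F} M fM adh; exists M.
  apply: lt_le_trans (fM _ Gg0); rewrite lt0r -lecR -fE frob_ge0 andbT.
  apply/eqP => f0; apply: ncomm.
  have /eqP : S - g0 *m S *m g0^t* = 0 by apply: frob_eq0; rewrite fE f0.
  rewrite subr_eq0 => /eqP SE; rewrite [in LHS]SE.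
  by rewrite -mulmxA (trmxCKl (unitary_group_unitarymx Gg0)) mulmx1.
move=> h h0; have [g Gg fg] := adh h h0; exists g; split=> //.
  by rewrite fE lecR ltW.
have GT : G (g *m S *m g^t*).
  exact: unitary_groupM (unitary_groupM Gg GS) (unitary_group_trmxC Gg).
have conjM c : c *m (g *m S *m g^t*) *m c^t* = c *m g *m S *m (c *m g)^t*.
  by rewrite [(c *m g)^t*]trmxCM !mulmxA.
move: (g *m S *m g^t*) GT conjM (fE g) (le1 g Gg) => T GT conjM fT leT.
pose c := S *m T *m S^t* *m T^t*.
have Gc : G c.
  have [GS' GT'] := (unitary_group_trmxC GS, unitary_group_trmxC GT).
  exact: unitary_groupM (unitary_groupM (unitary_groupM GS GT) GS') GT'.
have := frob_conj_commutator uS (unitary_group_unitarymx GT) leT.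
rewrite conjM fT -lerBrDr => /le_trans; apply; rewrite fE.
rewrite -rmorphB lecR lerBlDr; apply: le_trans (fM _ (unitary_groupM Gc Gg)) _.
by rewrite addrC -lerBlDr ltW.
Qed.

Lemma near_identity_central : (0 < n)%N ->
  ASM ((2 * n.+1 ^ 2)%:R^-1 : R) G ->
  exists2 e : R, 0 < e & forall S, G S -> frob (S - 1%:M) <= e%:C%C ->
    forall g, G g -> S *m g = g *m S.
Proof.
move=> n0 asm.
have [e e0 esc] := @rotation_escapes R (n.+1 ^ 2) (expn_gt0 _ _).
(* [m] will bound the squared distance from [S] to its conjugates: [m < e] keeps [l] near 1, and
   [m <= 1] permits [almost_commuting_conj]. The radius [m / 4] offsets the total factor 4 in
   [frob_conjB_le]. *)
have [m [m0 me m1]] : exists m : R, [/\ 0 < m, m < e & m <= 1].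
  exists (Num.min (e / 2) 1); rewrite lt_min divr_gt0// ltr01 gt_min ge_min lexx orbT.
  by split=> //; apply/orP; left; rewrite ltr_pdivrMr// ltr_pMr// ltr1n.
exists (m / 4); first by rewrite divr_gt0.
move=> S GS S1 g0 Gg0; apply: contrapT => ncomm.
have uS := unitary_group_unitarymx GS.
have conj_le g : G g -> frob (S - g *m S *m g^t*) <= m%:C%C.
  move=> Gg; apply: le_trans (frob_conjB_le _ (unitary_group_unitarymx Gg)) _.
  apply: (@le_trans _ _ (2 * (m / 4)%:C%C + 2 * (m / 4)%:C%C)).
    by apply: lerD; apply: ler_wpM2l S1.
  rewrite -(rmorph_nat (real_complex R)) -rmorphM -rmorphD lecR.
  by lra.
have conj_le1 g : G g -> frob (S - g *m S *m g^t*) <= 1.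
  move=> /conj_le/le_trans; apply.
  by rewrite -(rmorph1 (real_complex R)) lecR.
have [M M0 adh] := almost_commuting_conj GS Gg0 ncomm conj_le1.
(* [frob (S - T)] will be at least [M - h >= M / 2], and [eigenvalue_far] loses a factor [n + 1]. *)
pose l0 := M / 2 / n.+1%:R.
have l00 : 0 < l0 by rewrite !divr_gt0.
have [K escK] := esc l0 l00.
have eK0 : 0 < e / 8 ^+ K by rewrite divr_gt0// exprn_gt0.
(* [h < e / 8 ^+ K] keeps the error of [frob_mulX] below [e] for all [k <= K]. *)
have [h [h0 hM hK]] : exists h : R, [/\ 0 < h, h <= M / 2 & h < e / 8 ^+ K].
  exists (Num.min (M / 2) (e / 8 ^+ K / 2)).
  rewrite lt_min !divr_gt0 ?exprn_gt0// ge_min lexx gt_min; split=> //.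
  by apply/orP; right; rewrite ltr_pdivrMr// ltr_pMr// ltr1n.
have [g [Gg fg comm]] := adh h h0.
have ug := unitary_group_unitarymx Gg.
have GT : G (g *m S *m g^t*).
  exact: unitary_groupM (unitary_groupM Gg GS) (unitary_group_trmxC Gg).
have ST_le := conj_le g Gg.
have [I [p [Iq p1 pP]]] := ASM_power_eigenvalue n0 asm GS Gg.
move: (g *m S *m g^t*) GT fg comm ST_le pP => T GT fg comm ST_le pP.
have uT := unitary_group_unitarymx GT; have uT' : T^t* \is unitarymx by rewrite trmxC_unitary.
have [l [el l_near l_far]] := eigenvalue_far (mul_unitarymx uS uT').
have frobST : frob (S *m T^t* - 1%:M) = frob (S - T).
  by rewrite -(frob_mulUr _ uT) mulmxBl -mulmxA (trmxCKl uT) mulmx1 mul1mx.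
rewrite frobST in l_near l_far.
have [||k kK far] := escK I p l Iq p1.
- exact: eigenvalue_unitary_norm (mul_unitarymx uS uT') el.
- apply/andP; split; last first.
    by apply: le_lt_trans l_near _; apply: le_lt_trans ST_le _; rewrite ltcR.
  have : (M / 2)%:C%C <= n.+1%:R * `|l - 1| ^+ 2.
    apply: le_trans l_far; apply: le_trans fg; rewrite lecR.
    by rewrite lerBrDl -lerBrDr (le_trans hM)// lerBrDr -splitr.
  have -> : l0%:C%C = (M / 2)%:C%C / n.+1%:R by rewrite [LHS]rmorphM fmorphV rmorph_nat.
  by rewrite ler_pdivrMr ?ltr0n// [X in _ -> _ <= X]mulrC.
have [z ez zl] := eigenvalue_near
  (mul_unitarymx (unitarymxX k uS) (unitarymxX k uT')) (eigenvalueX k el).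
have [j] := pP k z ez; apply/negP; rewrite -ltNge; apply: far.
  exact: eigenvalue_unitary_norm (mul_unitarymx (unitarymxX k uS) (unitarymxX k uT')) ez.
apply: le_lt_trans zl _; apply: le_lt_trans (frob_mulX k uS uT') _.
have -> : frob (S * T^t* - T^t* * S) = frob (S *m T - T *m S).
  rewrite -!mulmxE frobBC -[LHS](frob_mulUl _ uT) -[LHS](frob_mulUr _ uT).
  rewrite mulmxBr mulmxBl !mulmxA; move/unitarymxP: (uT) => ->.
  by rewrite mul1mx -(mulmxA _ _ T) (trmxCKl uT) mulmx1.
apply: (@le_lt_trans _ _ (8 ^+ k * h%:C%C)); first by rewrite ler_pM2l// exprn_gt0.
rewrite -(rmorph_nat (real_complex R)) -rmorphXn -rmorphM ltcR /=.
apply: (@le_lt_trans _ _ (8 ^+ K * h)).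
  by rewrite ler_pM2r// ler_weXn2l// ler1n.
by rewrite mulrC -ltr_pdivlMr// exprn_gt0.
Qed.

End ASMGroup.

(** * Finiteness modulo the centre *)

Lemma unitarymx_entry (R : realType) (n : nat) (A : 'M[R[i]]_n) i j : A \is unitarymx ->
  complex.Re (A i j) ^+ 2 + complex.Im (A i j) ^+ 2 <= 1.
Proof.
move=> /row_unitarymxP/(_ i i); rewrite eqxx dotmxE mxE => rowi.
rewrite -lecR add_Re2_Im2 -[leRHS]rowi (bigD1 j)//= !mxE -normCK lerDl.
by apply: sumr_ge0 => k _; rewrite !mxE -normCK exprn_ge0.
Qed.

(** [c] records, entry by entry, which cells of side [1 / s] contain the real and imaginary
    parts. *)
Lemma unitarymx_net (R : realType) (n : nat) (d : R) : 0 < d ->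
  exists (T : finType) (c : 'M[R[i]]_n -> T), forall A B,
    A \is unitarymx -> B \is unitarymx -> c A = c B -> frob (A - B) <= d%:C%C.
Proof.
(* Each of the [n^2] entries contributes at most [2 / s^2], and [2 n^2 <= s d <= s^2 d]. *)
move=> d0; pose s := (Num.truncn ((2 * n ^ 2)%:R / d)).+1.
have sd : (2 * n ^ 2)%:R <= s%:R * d :> R by rewrite -ler_pdivrMr// ltW// truncnS_gt.
have s1 : 1 <= s%:R :> R by rewrite ler1n.
have s0 : 0 < s%:R :> R by rewrite ltr0n.
(* The shift by 1 moves [[-1, 1]] to [[0, 2]], whose closed end needs the index [2 s], hence
   [2 s + 1] cells. *)
pose cell (x : R) : 'I_(2 * s).+1 := inord (Num.truncn (s%:R * (x + 1))).
have cellP (x y : R) : x ^+ 2 <= 1 -> y ^+ 2 <= 1 -> cell x = cell y ->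
    (x - y) ^+ 2 <= s%:R ^- 2.
  move=> x1 y1 /(congr1 val) /=.
  have itv (w : R) : w ^+ 2 <= 1 -> 0 <= w + 1 <= 2.
    by move=> w1; apply/andP; split; nra.
  have bnd (w : R) : w ^+ 2 <= 1 -> (Num.truncn (s%:R * (w + 1)) < (2 * s).+1)%N.
    move=> /itv/andP[w1 w2]; rewrite ltnS -(ler_nat R) natrM.
    have /andP[+ _] := truncn_itv (mulr_ge0 (ltW s0) w1); move/le_trans; apply.
    by rewrite mulrC ler_pM2r.
  rewrite !inordK ?bnd// => E.
  have [/andP[x2 _] /andP[y2 _]] := (itv _ x1, itv _ y1).
  have /andP[] := truncn_itv (mulr_ge0 (ltW s0) x2).
  have /andP[] := truncn_itv (mulr_ge0 (ltW s0) y2).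
  rewrite E -natr1; set t := _%:R => h1 h2 h3 h4.
  rewrite -[leRHS]mul1r ler_pdivlMr ?exprn_gt0// -exprMn.
  have : -1 <= (x - y) * s%:R <= 1 by apply/andP; split; lra.
  by move=> /andP[? ?]; nra.
exists {ffun 'I_n * 'I_n -> 'I_(2 * s).+1 * 'I_(2 * s).+1}.
exists (fun A => [ffun x => (cell (complex.Re (A x.1 x.2)), cell (complex.Im (A x.1 x.2)))]).
move=> A B uA uB /ffunP cE.
have entry i j : `|(A - B) i j| ^+ 2 <= (2 * s%:R ^- 2)%:C%C.
  have := cE (i, j); rewrite !ffunE /= => -[c1 c2].
  have := unitarymx_entry i j uA; have := unitarymx_entry i j uB.
  rewrite -add_Re2_Im2 lecR !mxE.
  case: (A i j) c1 c2 => a a'; case: (B i j) => b b' /= c1 c2 hb ha.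
  have ? := sqr_ge0 a; have ? := sqr_ge0 a'; have ? := sqr_ge0 b; have ? := sqr_ge0 b'.
  have [] : (a - b) ^+ 2 <= s%:R ^- 2 /\ (a' - b') ^+ 2 <= s%:R ^- 2.
    by split; apply: cellP => //; lra.
  by lra.
rewrite frobE; apply: (@le_trans _ _ (\sum_(i < n) \sum_(j < n) (2 * s%:R ^- 2)%:C%C)).
  by apply: ler_sum => i _; apply: ler_sum => j _.
rewrite !sumr_const card_ord -mulrnA mulnn -rmorphMn lecR.
rewrite -[_ *+ _]mulr_natr mulrAC -natrM ler_pdivrMr ?exprn_gt0//.
apply: le_trans sd _; rewrite mulrC ler_pM2l// expr2 ler_peMl// ltW//.
Qed.

(** If [a] and [b] in [G] share a cell of the net, [b^* a] is near 1, hence central, and their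
    cosets agree; so there are no more cosets than cells. *)
Lemma finite_mod_centre_of_net (R : realType) (n : nat) (G : set 'M[R[i]]_n.+1) (d : R) :
  unitary_group G -> 0 < d ->
  (forall S, G S -> frob (S - 1%:M) <= d%:C%C -> forall g, G g -> S *m g = g *m S) ->
  finite_mod_centre G.
Proof.
move=> Ggrp d0 central.
have [T [c cP]] := @unitarymx_net R n.+1 d d0.
pose coset (g : 'M[R[i]]_n.+1) := [set g *m z | z in centre G]%classic.
(* A chosen element of the cell [t]; the default 1 serves for cells without elements of [G]. *)
pose F t := coset (xget 1%:M [set g | G g /\ c g = t]%classic).
apply: (@sub_finite_set _ _ (F @` [set: T])%classic); last exact: finite_image.
move=> _ [g Gg <-]; exists (c g) => //; rewrite /F.
have := @xgetPex _ 1%:M [set g0 | G g0 /\ c g0 = c g]%classic.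
move=> /(_ (ex_intro _ g (conj Gg erefl))); set g' := xget _ _ => -[Gg' cg'].
have sub a b : G a -> G b -> c a = c b -> (coset a `<=` coset b)%classic.
  move=> Ga Gb cab _ [z [Gz zC] <-].
  have [ua ub] := (unitary_group_unitarymx Ggrp Ga, unitary_group_unitarymx Ggrp Gb).
  pose w := (map_mx Num.conj (b^T))%R *m a.
  have Gw : G w by apply: unitary_groupM => //; exact: unitary_group_trmxC.
  have wC h : G h -> w *m h = h *m w.
    by apply: central => //; rewrite frob_unitaryB1// frobBC cP.
  exists (w *m z); last by rewrite /w !mulmxA; move/unitarymxP: ub => ->; rewrite mul1mx.
  split=> [|h Gh]; first exact: unitary_groupM.
  by rewrite -(mulmxA w) (zC h Gh) (mulmxA w) (wC h Gh) -mulmxA.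
by apply/seteqP; split; apply: sub.
Qed.

(* n.+1 ranges over all dimensions >= 1 *)
Theorem theorem6 (R : realType) (n : nat) (G : set 'M[R[i]]_n.+1) :
  unitary_group G ->
  ASM ((2 * n.+1 ^ 2)%:R^-1 : R) G ->
  finite_mod_centre G.
Proof.
move=> Ggrp asm; case: (posnP n) => [n0|n0]; last first.
  have [e e0 central] := near_identity_central Ggrp n0 asm.
  exact: finite_mod_centre_of_net central.
(* In dimension one all matrices commute, so any radius works, here 1. *)
apply: (finite_mod_centre_of_net Ggrp ltr01) => S _ _ g _; subst n.
by rewrite [S]mx11_scalar [g]mx11_scalar -!scalar_mxM mulrC.
Qed.
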